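(* Let $L>0$ and $r\in(0,1)$, and for each integer $M\ge \frac{r}{1-r}$ let the actuator centers be $$c_j^M:=\frac{jL}{M+1},\qquad j\in\{1,2,\dots,M\}.$$ Let $\omega_j^M:=\big(c_j^M-\tfrac{rL}{2M},c_j^M+\tfrac{rL}{2M}\big)$, let $U(c^M):=\operatorname{span}\{1_{\omega_j^M}\mid 1\le j\le M\}$, and let $E_M\subset L^2(0,L)$ be the linear span of the first $M$ Dirichlet eigenfunctions of $-\Delta$ on $(0,L)$. Then the oblique projection $P_{U(c^M)}^{E_M^\perp}:L^2(0,L)\to L^2(0,L)$ is well defined and its operator norm is $$\Big\|P_{U(c^M)}^{E_M^\perp}\Big\|=\left(\frac{4(M+1)}{r\pi^2M}\sin^2\left(\frac{r\pi}{2}\right)\right)^{-\frac12}\qquad\text{for } M\ge\frac{r}{1-r}.$$ In particular, the sequence of norms $\|P_{U(c^M)}^{E_M^\perp}\|$ increases, for integers $M\ge\frac{r}{1-r}$, and converges to $\dfrac{\sqrt r\,\pi}{2\sin\left(\frac{r\pi}{2}\right)}$.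
   Context: $1_\omega$ is the indicator function of $\omega$. The Dirichlet eigenfunctions of $-\Delta=-\frac{d^2}{dx^2}$ on $(0,L)$ are ordered by increasing eigenvalue; the $i$-th one is a multiple of $\sin(i\pi x/L)$, $i\ge1$. $E_M^\perp$ is the orthogonal complement of $E_M$ in $L^2(0,L)$. $\|\cdot\|$ is the operator norm in $\mathcal L(L^2(0,L))$. Oblique projection: if a Hilbert space $H$ is a direct sum $H=F\oplus E$ of closed subspaces, $P_F^E:H\to F$ is the projection onto $F$ along $E$, i.e. $P_F^Ex=x_F$ where $x=x_F+x_E$ is the unique decomposition with $(x_F,x_E)\in F\times E$. The projection is well defined exactly when the direct sum holds. *)

(* Defs.v *)
From HB Require Import structures.
From mathcomp Require Import all_boot all_order all_algebra.
From mathcomp Require Import all_classical all_reals all_analysis.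
From mathcomp Require Import measurable_realfun ess_sup_inf ring.

Set Implicit Arguments.
Unset Strict Implicit.
Unset Printing Implicit Defensive.

Import Order.TTheory GRing.Theory Num.Theory.
Import numFieldNormedType.Exports.

Local Open Scope classical_set_scope.
Local Open Scope quotient_scope.
Local Open Scope ring_scope.

(* MathComp-Analysis defines the type [LspaceType mu p1] of classes modulo
   [ae_eq] of measurable functions of finite L^p norm, but equips it with no
   algebraic or topological structure. This section makes it a [normedModType]
   for pointwise operations on representatives and the library norm [Lnorm]. *)
Section LspaceAlgebra.
Context d (T : measurableType d) (R : realType).
Variables (mu : {measure set T -> \bar R}) (p : \bar R) (p1 : (1 <= p)%E).
Notation Lsp := (LspaceType mu p1).
Notation Lf := (LfunType mu p1).
Section repack.
Variables (f : T -> R) (fP : f \in Lfun mu p).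
Let mf : measurable_fun [set: T] (f : T -> measurableTypeR R).
Proof.
have := set_mem (sub_Lfun_mfun fP) => h mT Y mY.
by apply: h => //; exact: mY.
Qed.
HB.instance Definition _ := isMeasurableFun.Build _ _ _ _ (f : T -> measurableTypeR R) mf.
(* [measurableTypeR R] and [R] carry the same measurable sets but distinct
   structures, hence this repackaging of [f]. *)
Definition mfunR : {mfun T >-> measurableTypeR R} := (f : T -> measurableTypeR R).
End repack.

Lemma Lnorm_ae_eq (f g : T -> R) :
  measurable_fun [set: T] f -> measurable_fun [set: T] g ->
  f = g %[ae mu] -> ('N[mu]_p[EFin \o f] = 'N[mu]_p[EFin \o g])%E.
Proof.
move=> mf mg fg; rewrite unlock; case: p p1 => [r _| _ |//].
- congr (_ `^ _)%E; apply: ge0_ae_eq_integral => //=.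
  + apply/measurable_EFinP/(@measurableT_comp _ _ _ _ _ _ (@powR R ^~ r)) => //.
    exact: measurableT_comp.
  + apply/measurable_EFinP/(@measurableT_comp _ _ _ _ _ _ (@powR R ^~ r)) => //.
    exact: measurableT_comp.
  + by apply: filterS fg => x fgx _; rewrite /= fgx.
- case: ifPn => // _; apply: eq_ess_sup.
  by apply: filterS fg => x fgx; rewrite /= fgx.
Qed.

Lemma repr_Lfun (u : Lsp) : (u : T -> R) \in Lfun mu p.
Proof.
apply/andP; split; rewrite inE/=; last by case: u => g [[]].
have h := @measurable_funPT _ _ _ _ (repr (u : {mfun_ mu, T >-> measurableTypeR R})).
move=> mT Y mY; apply: h => //; exact: mY.
Qed.

Lemma pi_ae (f : {mfun T >-> measurableTypeR R}) :
  (repr (\pi_({mfun_ mu, T >-> measurableTypeR R}) f) : T -> R) = f %[ae mu].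
Proof.
have /eqP := reprK (\pi_({mfun_ mu, T >-> measurableTypeR R}) f).
by rewrite eqmodE => /asboolP.
Qed.

Definition mfun_class (f : T -> R) (fP : f \in Lfun mu p) :
    {mfun_ mu, T >-> measurableTypeR R} :=
  \pi_({mfun_ mu, T >-> measurableTypeR R}) (mfunR fP).

Fact Lspace_of_subproof (f : T -> R) (fP : f \in Lfun mu p) :
  finite_norm mu p (mfun_class fP).
Proof.
rewrite /finite_norm (@Lnorm_ae_eq _ f).
- exact: (set_mem (sub_Lfun_finLfun fP)).
- move=> mT Y mY.
  have h := @measurable_funPT _ _ _ _
    (repr (\pi_({mfun_ mu, T >-> measurableTypeR R}) (mfunR fP))).
  by apply: h => //; exact: mY.
- exact: (set_mem (sub_Lfun_mfun fP)).
- exact: pi_ae.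
Qed.

Definition Lspace_of (f : T -> R) (fP : f \in Lfun mu p) : Lsp :=
  LebesgueSpace.Pack (LebesgueSpace.Class
    (@isFinLebesgue.Axioms_ d T R mu p p1 _ (Lspace_of_subproof fP))).

Lemma Lspace_ofE (f : T -> R) (fP : f \in Lfun mu p) :
  (Lspace_of fP : T -> R) = f %[ae mu].
Proof. exact: pi_ae. Qed.

Lemma Lspace_ae_eq (u v : Lsp) : (u : T -> R) = v %[ae mu] -> u = v.
Proof.
move=> uv.
have : LebesgueSpace.sort u = LebesgueSpace.sort v.
  rewrite -[LHS]reprK -[RHS]reprK; apply/eqP; rewrite eqmodE; exact/asboolP.
case: u v {uv} => [f [[fi]]] [g [[gi]]] /= fg.
by subst g; rewrite (bool_irrelevance fi gi).
Qed.

Let ofP {f g : T -> R} (fP : f \in Lfun mu p) (gP : g \in Lfun mu p) :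
  f = g %[ae mu] -> Lspace_of fP = Lspace_of gP.
Proof.
move=> fg; apply: Lspace_ae_eq; apply: ae_eq_trans; first exact: Lspace_ofE.
by apply: ae_eq_trans; [exact: fg|apply: ae_eq_sym; exact: Lspace_ofE].
Qed.

Let Lfun0 : 0 \in Lfun mu p. Proof. exact: (Lfun_submod_closed mu p1).1. Qed.
Let LfunZD a f g : f \in Lfun mu p -> g \in Lfun mu p -> a *: f + g \in Lfun mu p.
Proof. exact: (Lfun_submod_closed mu p1).2. Qed.
Let LfunD f g : f \in Lfun mu p -> g \in Lfun mu p -> f + g \in Lfun mu p.
Proof. by move=> fP gP; rewrite -[f]scale1r; exact: LfunZD. Qed.
Let LfunZ a f : f \in Lfun mu p -> a *: f \in Lfun mu p.
Proof. by move=> fP; rewrite -[X in X \in _]addr0; exact: LfunZD. Qed.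
Let LfunN f : f \in Lfun mu p -> - f \in Lfun mu p.
Proof. by move=> fP; rewrite -scaleN1r; exact: LfunZ. Qed.

HB.instance Definition _ := gen_eqMixin Lsp.
HB.instance Definition _ := gen_choiceMixin Lsp.

Let zero : Lsp := Lspace_of Lfun0.
Let opp (u : Lsp) : Lsp := Lspace_of (LfunN (repr_Lfun u)).
Let add (u v : Lsp) : Lsp := Lspace_of (LfunD (repr_Lfun u) (repr_Lfun v)).
Let scale (a : R) (u : Lsp) : Lsp := Lspace_of (LfunZ a (repr_Lfun u)).

Let zeroE : (zero : T -> R) = 0 %[ae mu]. Proof. exact: Lspace_ofE. Qed.
Let oppE u : (opp u : T -> R) = \- u %[ae mu]. Proof. exact: Lspace_ofE. Qed.
Let addE u v : (add u v : T -> R) = u \+ v %[ae mu].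
Proof. exact: Lspace_ofE. Qed.
Let scaleE a u : (scale a u : T -> R) = a \*: (u : T -> R^o) %[ae mu].
Proof. exact: Lspace_ofE. Qed.

Let addA : associative add.
Proof.
move=> u v w; apply: Lspace_ae_eq.
apply: filterS2 (filterI (addE u (add v w)) (addE v w))
  (filterI (addE (add u v) w) (addE u v)) => x /= [h1 h2] [h3 h4] _.
by rewrite h1// h2// h3// h4// addrA.
Qed.
Let addC : commutative add.
Proof.
move=> u v; apply: Lspace_ae_eq.
by apply: filterS2 (addE u v) (addE v u) => x /= h1 h2 _; rewrite h1// h2// addrC.
Qed.
Let add0 : left_id zero add.
Proof.
move=> u; apply: Lspace_ae_eq.
by apply: filterS2 (addE zero u) zeroE => x /= h1 h2 _; rewrite h1// h2// add0r.
Qed.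
Let addN : left_inverse zero opp add.
Proof.
move=> u; apply: Lspace_ae_eq.
apply: filterS3 (addE (opp u) u) zeroE (oppE u) => x /= h1 h2 h3 _.
by rewrite h1// h2// h3// addNr.
Qed.

HB.instance Definition _ := GRing.isZmodule.Build Lsp addA addC add0 addN.

Let scaleA a b u : scale a (scale b u) = scale (a * b) u.
Proof.
apply: Lspace_ae_eq.
apply: filterS3 (scaleE a (scale b u)) (scaleE b u) (scaleE (a * b) u)
  => x /= h1 h2 h3 _.
by rewrite h1// h2// h3// scalerA.
Qed.
Let scale1 : left_id 1 scale.
Proof.
move=> u; apply: Lspace_ae_eq.
by apply: filterS (scaleE 1 u) => x /= h1 _; rewrite h1// scale1r.
Qed.
Let scaleDr : right_distributive scale +%R.
Proof.
move=> a u v; apply: Lspace_ae_eq.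
apply: filterS3 (filterI (scaleE a (u + v)) (addE u v))
  (filterI (scaleE a u) (scaleE a v)) (addE (scale a u) (scale a v))
  => x /= [h1 h2] [h3 h4] h5 _.
by rewrite h1// h2// h5// h3// h4// scalerDr.
Qed.
Let scaleDl u : {morph scale^~ u : a b / a + b}.
Proof.
move=> a b; apply: Lspace_ae_eq.
apply: filterS2 (filterI (scaleE (a + b) u) (addE (scale a u) (scale b u)))
  (filterI (scaleE a u) (scaleE b u)) => x /= [h1 h2] [h3 h4] _.
by rewrite h1// h2// h3// h4// scalerDl.
Qed.

HB.instance Definition _ :=
  GRing.Zmodule_isLmodule.Build R Lsp scaleA scale1 scaleDr scaleDl.

Lemma LspaceD (u v : Lsp) : ((u + v : Lsp) : T -> R) = u \+ v %[ae mu].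
Proof. exact: addE. Qed.
Lemma LspaceZ (a : R) (u : Lsp) :
  ((a *: u : Lsp) : T -> R) = (fun x => a * u x) %[ae mu].
Proof. exact: scaleE. Qed.
Lemma Lspace0 : ((0 : Lsp) : T -> R) = cst 0 %[ae mu].
Proof. exact: zeroE. Qed.
Lemma LspaceN (u : Lsp) : ((- u : Lsp) : T -> R) = \- u %[ae mu].
Proof. exact: oppE. Qed.

Let measLsp (u : Lsp) : measurable_fun [set: T] (u : T -> R).
Proof. exact: (set_mem (sub_Lfun_mfun (repr_Lfun u))). Qed.

Let norm (u : Lsp) : R := fine ('N[mu]_p[EFin \o u])%E.

Let normE (u : Lsp) (f : Lf) : (u : T -> R) = f %[ae mu] ->
  norm u = fine ('N[mu]_p[EFin \o f])%E.
Proof. by move=> uf; rewrite /norm (Lnorm_ae_eq _ _ uf). Qed.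

Let normD (u v : Lsp) : norm (u + v) <= norm u + norm v.
Proof.
pose f : Lf := Lfun_Sub p1 (repr_Lfun u); pose g : Lf := Lfun_Sub p1 (repr_Lfun v).
rewrite (@normE u f); last exact: ae_eq_refl.
rewrite (@normE v g); last exact: ae_eq_refl.
rewrite (@normE _ (f + g)); last exact: LspaceD.
exact: ler_LnormD.
Qed.
Let normZ (a : R) (u : Lsp) : norm (a *: u) = `|a| * norm u.
Proof.
pose f : Lf := Lfun_Sub p1 (repr_Lfun u).
rewrite (@normE u f); last exact: ae_eq_refl.
rewrite (@normE _ (a *: f)); last exact: LspaceZ.
by rewrite LnormZ fineM// -finite_norm_fine.
Qed.
Let norm_eq0 (u : Lsp) : norm u = 0 -> u = 0.
Proof.
move=> u0; apply: Lspace_ae_eq.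
pose f : Lf := Lfun_Sub p1 (repr_Lfun u).
have /fine_Lnormr_eq0 f0 : fine ('N[mu]_p[EFin \o f])%E = 0 by [].
by apply: ae_eq_trans; [exact: f0|apply: ae_eq_sym; exact: Lspace0].
Qed.

HB.instance Definition _ :=
  Lmodule_isNormed.Build R Lsp normD normZ norm_eq0.

Lemma LspaceNormE (u : Lsp) : `|u| = fine ('N[mu]_p[EFin \o u])%E.
Proof. by []. Qed.

End LspaceAlgebra.

Section ObliqueProjection.
Context (R : realType) (V : normedModType R).
Implicit Types (F E : set V).

Definition is_subspace F :=
  F 0 /\ forall (a : R) u v, F u -> F v -> F (a *: u + v).

Definition lin_span n (v : 'I_n -> V) : set V :=
  [set \sum_(i < n) a i *: v i | a in [set: 'I_n -> R]].

Definition direct_sum F E :=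
  [/\ is_subspace F /\ closed F, is_subspace E /\ closed E &
      forall x : V, exists! y : V * V, [/\ F y.1, E y.2 & x = y.1 + y.2]].

(* The component in [F] of [x] along [E]; the value 0 is taken when [x] has no
   decomposition, which [direct_sum F E] excludes. *)
Definition oblique_proj F E (x : V) : V :=
  xget 0 [set y | F y /\ exists2 z, E z & x = y + z].

(* Valued in [\bar R]: an unbounded operator has norm +oo, so that equality with
   a real number includes boundedness. *)
Definition opnorm (W : normedModType R) (f : V -> W) : \bar R :=
  ereal_sup [set (`|f x|)%:E | x in [set x : V | `|x| <= 1]].

End ObliqueProjection.

Definition dirichlet_mode (R : realType) (L : R) (k : nat) (x : R) : R :=
  sin (k%:R * pi * x / L).

Section DirichletEigenfunctions.
Context (R : realType) (L : R).
Hypothesis L0 : 0 < L.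

Definition dirichlet_eigenfunction (lam : R) (f : R -> R) :=
  [/\ {within `[0, L], continuous f}, f 0 = 0 /\ f L = 0,
      exists2 x, x \in `]0, L[ & f x != 0,
      forall x, x \in `]0, L[ -> derivable f x 1 /\ derivable (derive1 f) x 1 &
      forall x, x \in `]0, L[ -> - derive1 (derive1 f) x = lam * f x].

Let cst_oo (a b : R) (h : R -> R) :
  (forall x, x \in `]a, b[ -> is_derive x 1 h 0) ->
  {in `]a, b[ &, forall x y, h x = h y}.
Proof.
move=> dh.
suff H x y : x <= y -> x \in `]a, b[ -> y \in `]a, b[ -> h x = h y.
  by move=> x y xab yab; have [/ltW|] := ltP x y => xy; [|symmetry]; apply: H.
move=> xy; rewrite !in_itv/= => /andP[ax xb] /andP[ay yb].
have hd z : z \in `]x, y[ -> is_derive z 1 h (cst 0 z).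
  rewrite in_itv/= => /andP[xz zy].
  by apply: dh; rewrite in_itv/= (lt_trans ax xz) (lt_trans zy yb).
have hc : {within `[x, y], continuous h}.
  apply: derivable_within_continuous => z; rewrite in_itv/= => /andP[xz zy].
  have zab : z \in `]a, b[ by rewrite in_itv/= (lt_le_trans ax xz) (le_lt_trans zy yb).
  by have [] := dh z zab.
have [z _ /eqP] := MVT_segment xy hd hc.
by rewrite mul0r subr_eq0 => /eqP.
Qed.

Let cont0 (k : R -> R) : {within `[0, L], continuous k} ->
  (forall x, x \in `]0, L[ -> k x = 0) -> k 0 = 0 /\ k L = 0.
Proof.
move=> /(continuous_within_itvP _ L0)[_ k0 kL] k_eq0; split.
- apply/esym/(@cvg_unique _ _ (k x @[x --> 0^'+])) => //.
  apply: (@cvg_trans _ ((fun=> 0 : R) @ 0^'+)); last exact: cvg_cst.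
  apply: near_eq_cvg; near=> x; rewrite k_eq0// in_itv/=; apply/andP; split.
    by near: x; exact: nbhs_right_gt.
  by near: x; exact: nbhs_right_lt.
- apply/esym/(@cvg_unique _ _ (k x @[x --> L^'-])) => //.
  apply: (@cvg_trans _ ((fun=> 0 : R) @ L^'-)); last exact: cvg_cst.
  apply: near_eq_cvg; near=> x; rewrite k_eq0// in_itv/=; apply/andP; split.
    by near: x; exact: nbhs_left_gt.
  by near: x; exact: nbhs_left_lt.
Unshelve. all: by end_near. Qed.

Let sin_eq0_pos (x : R) : 0 < x -> sin x = 0 -> exists n : nat, x = n.+1%:R * pi.
Proof.
move=> x0 sx.
have pi0 := @pi_gt0 R.
pose n := Num.truncn (x / pi).
have /andP[nx xn] : n%:R <= x / pi < n.+1%:R by apply: truncn_itv; rewrite divr_ge0// ltW.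
pose y := x - n%:R * pi.
have y0 : 0 <= y by rewrite subr_ge0 -ler_pdivlMr.
have ypi : y < pi by rewrite ltrBlDr -[X in X + _]mul1r -mulrDl nat1r -ltr_pdivrMr.
have sy : sin y = 0.
  have : sin (y + pi *+ n) = 0 by rewrite /y -[pi *+ n]mulr_natl subrK.
  rewrite (alternatingn (@sinDpi R)) => /eqP.
  by rewrite mulf_eq0 signr_eq0 => /eqP.
have y00 : y = 0.
  apply/eqP; move: y0; rewrite le_eqVlt => /orP[/eqP<-//|y0].
  by have := @sin_gt0_pi R y; rewrite y0 ypi sy ltxx => /(_ isT).
have xE : x = n%:R * pi by apply/eqP; rewrite -subr_eq0 -/y y00.
case: n xE {nx xn y y0 ypi sy y00} => [|n] xE; last by exists n.
by move: x0; rewrite xE mul0r ltxx.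
Qed.

Section Necessity.
Variables (lam : R) (f : R -> R).
Hypothesis cf : {within `[0, L], continuous f}.
Hypothesis f0 : f 0 = 0.
Hypothesis fL : f L = 0.
Hypothesis fn0 : exists2 x, x \in `]0, L[ & f x != 0.
Hypothesis df : forall x, x \in `]0, L[ -> is_derive x 1 f (derive1 f x).
Hypothesis ddf : forall x, x \in `]0, L[ -> is_derive x 1 (derive1 f) (- (lam * f x)).

Let lam_gt0 : 0 < lam.
Proof.
rewrite ltNge; apply/negP => lam0.
pose phi x := f x * derive1 f x.
have dphi x : x \in `]0, L[ -> is_derive x 1 phi (derive1 f x ^+ 2 - lam * f x ^+ 2).
  move=> xL; have := df xL; have := ddf xL => h1 h2.
  by apply: is_derive_eq; rewrite /GRing.scale/=; ring.
have dphi1 x (xL : x \in `]0, L[) : derive1 phi x = derive1 f x ^+ 2 - lam * f x ^+ 2.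
  by have h := dphi x xL; rewrite derive1E derive_val.
have phi_nd x y : x \in `]0, L[ -> y \in `]0, L[ -> x <= y -> phi x <= phi y.
  move=> xL yL xy.
  have sub z : z \in `[x, y] -> z \in `]0, L[.
    move: xL yL; rewrite !in_itv/= => /andP[x0 _] /andP[_ yL] /andP[xz zy].
    by rewrite (lt_le_trans x0 xz) (le_lt_trans zy yL).
  have subo z : z \in `]x, y[ -> z \in `]0, L[.
    by move=> zxy; apply: sub; move: zxy; rewrite !in_itv/= => /andP[/ltW-> /ltW->].
  apply: (@ger0_derive1_le_cc R phi x y); rewrite ?in_itv/= ?lexx ?xy//.
  - by move=> z /subo zL; have [] := dphi z zL.
  - move=> z /subo zL; rewrite dphi1//.
    by rewrite addr_ge0 ?sqr_ge0// oppr_ge0 mulr_le0_ge0// sqr_ge0.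
  - apply: derivable_within_continuous => z /sub zL; by have [] := dphi z zL.
pose q x := f x ^+ 2.
have dq x : x \in `]0, L[ -> is_derive x 1 q (2 * phi x).
  move=> xL; have := df xL => h2.
  by apply: is_derive_eq; rewrite /GRing.scale/= /phi; ring.
have dq1 x (xL : x \in `]0, L[) : derive1 q x = 2 * phi x.
  by have h := dq x xL; rewrite derive1E derive_val.
have cq : {within `[0, L], continuous q}.
  by move=> x; apply: cvgM; exact: cf.
have [x0 x0L fx0] := fn0.
have qx0 : 0 < q x0 by rewrite exprn_even_gt0.
have /andP[x00 x0L'] : 0 < x0 < L by move: x0L; rewrite in_itv.
have [phi0|phi0] := leP 0 (phi x0).
- have : q x0 <= q L.
    apply: (@ger0_derive1_le_cc R q x0 L); rewrite ?in_itv/= ?lexx ?(ltW x0L')//.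
    + move=> z; rewrite in_itv/= => /andP[xz zL].
      by have [] := dq z; rewrite ?in_itv/= ?zL ?(lt_trans x00).
    + move=> z; rewrite in_itv/= => /andP[xz zL].
      have zL' : z \in `]0, L[ by rewrite in_itv/= zL (lt_trans x00).
      by rewrite dq1// mulr_ge0// (le_trans phi0)// phi_nd// ltW.
    + apply: continuous_subspaceW cq => z /=; rewrite !in_itv/= => /andP[xz ->].
      by rewrite (le_trans (ltW x00)).
  by rewrite [q L]/q fL expr0n/= leNgt qx0.
- have : q x0 <= q 0.
    apply: (@ler0_derive1_le_cc R q 0 x0); rewrite ?in_itv/= ?lexx ?(ltW x00)//.
    + move=> z; rewrite in_itv/= => /andP[xz zL].
      by have [] := dq z; rewrite ?in_itv/= ?xz ?(lt_trans zL).
    + move=> z; rewrite in_itv/= => /andP[xz zL].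
      have zL' : z \in `]0, L[ by rewrite in_itv/= xz (lt_trans zL).
      rewrite dq1// mulr_ge0_le0// (@le_trans _ _ (phi x0))//; last exact: ltW.
      by rewrite phi_nd// ltW.
    + apply: continuous_subspaceW cq => z /=; rewrite !in_itv/= => /andP[-> xz].
      by rewrite (le_trans xz (ltW x0L')).
  by rewrite [q 0]/q f0 expr0n/= leNgt qx0.
Qed.

Let w := Num.sqrt lam.
Let w2 : w ^+ 2 = lam. Proof. by rewrite sqr_sqrtr// ltW. Qed.
Let w0 : 0 < w. Proof. by rewrite sqrtr_gt0. Qed.

Let dsinw (x : R) : is_derive x 1 (fun x : R => sin (w * x)) (w * cos (w * x)).
Proof.
have h : is_derive x 1 (fun x : R => w * x) w.
  by apply: is_derive_eq; rewrite /GRing.scale/= mulr1.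
by apply: is_derive_eq (is_derive1_comp _ h) _; rewrite /GRing.scale/= mulrC.
Qed.
Let dcosw (x : R) : is_derive x 1 (fun x : R => cos (w * x)) (- w * sin (w * x)).
Proof.
have h : is_derive x 1 (fun x : R => w * x) w.
  by apply: is_derive_eq; rewrite /GRing.scale/= mulr1.
by apply: is_derive_eq (is_derive1_comp _ h) _; rewrite /GRing.scale/=; ring.
Qed.
#[local] Existing Instance dsinw.
#[local] Existing Instance dcosw.

Fact dirichlet_sine : exists k : nat, lam = (k.+1%:R * pi / L) ^+ 2 /\
  exists2 c, c != 0 & {in `[0, L], forall x, f x = c * dirichlet_mode L k.+1 x}.
Proof.
pose g (x : R) := derive1 f x * sin (w * x) - w * f x * cos (w * x).
pose h (x : R) := derive1 f x * cos (w * x) + w * f x * sin (w * x).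
have dg x : x \in `]0, L[ -> is_derive x 1 g 0.
  move=> xL; have := df xL; have := ddf xL => h1 h2.
  by apply: is_derive_eq; rewrite /GRing.scale/= -w2; ring.
have dh x : x \in `]0, L[ -> is_derive x 1 h 0.
  move=> xL; have := df xL; have := ddf xL => h1 h2.
  by apply: is_derive_eq; rewrite /GRing.scale/= -w2; ring.
have [x0 x0L fx0] := fn0.
pose G := g x0; pose H := h x0.
pose k (x : R) := w * f x - H * sin (w * x) + G * cos (w * x).
have k_eq0 x : x \in `]0, L[ -> k x = 0.
  move=> xL.
  rewrite /k /G /H (cst_oo dg x0L xL) (cst_oo dh x0L xL) /g /h.
  transitivity (w * f x * (1 - (cos (w * x) ^+ 2 + sin (w * x) ^+ 2))).
    by ring.
  by rewrite cos2Dsin2 subrr mulr0.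
have ck : {within `[0, L], continuous k}.
  have csin : {within `[0, L], continuous (fun x : R => sin (w * x))}.
    by apply: derivable_within_continuous => x _; have [] := dsinw x.
  have ccos : {within `[0, L], continuous (fun x : R => cos (w * x))}.
    by apply: derivable_within_continuous => x _; have [] := dcosw x.
  move=> x; apply: cvgD; first apply: cvgB.
  - by apply: cvgMr; exact: cf.
  - by apply: cvgMr; exact: csin.
  - by apply: cvgMr; exact: ccos.
have [k0 kL] := cont0 ck k_eq0.
have k_eq x : x \in `[0, L] -> k x = 0.
  rewrite in_itv/= !le_eqVlt => /andP[/orP[/eqP<-//|x0'] /orP[/eqP->//|xL]].
  by apply: k_eq0; rewrite in_itv/= x0' xL.
have G0 : G = 0.
  by move: k0; rewrite /k f0 !mulr0 sin0 cos0 mulr0 subr0 add0r mulr1.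
have fE x : x \in `[0, L] -> f x = H / w * sin (w * x).
  move=> /k_eq; rewrite /k G0 mul0r addr0 => /eqP; rewrite subr_eq0 => /eqP e.
  by rewrite mulrAC -e mulrAC divff ?mul1r// gt_eqF.
have H0 : H != 0.
  apply: contra_neq fx0 => H0; rewrite fE ?H0 ?mul0r//.
  by move: x0L; rewrite !in_itv/= => /andP[/ltW-> /ltW->].
have sinL : sin (w * L) = 0.
  have LL : L \in `[0, L] by rewrite in_itv/= lexx ltW.
  have := fE _ LL; rewrite fL => /esym/eqP.
  by rewrite !mulf_eq0 invr_eq0 (negbTE H0) (gt_eqF w0)/= => /eqP.
have [n wL] := sin_eq0_pos (mulr_gt0 w0 L0) sinL.
have wE : w = n.+1%:R * pi / L by rewrite -wL mulfK// gt_eqF.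
exists n; split; first by rewrite -wE w2.
exists (H / w); first by rewrite mulf_neq0// invr_eq0 gt_eqF.
by move=> x /fE ->; rewrite /dirichlet_mode; congr (_ * sin _); rewrite wE mulrAC.
Qed.
End Necessity.

(* The eigenvalues are the (k pi / L)^2, k >= 1, all simple, and the k-th
   eigenfunction is a multiple of [dirichlet_mode L k]. *)
Lemma dirichlet_eigenfunctionP (lam : R) (f : R -> R) :
  dirichlet_eigenfunction lam f <->
  exists k : nat, lam = (k.+1%:R * pi / L) ^+ 2 /\
    exists2 c, c != 0 &
      {in `[0, L], forall x, f x = c * dirichlet_mode L k.+1 x}.
Proof.
split=> [[cf [f0 fL] fn0 df ddf]|[k [-> [c c0 fE]]]].
  apply: (dirichlet_sine cf f0 fL fn0).
  - by move=> x /df[dfx _]; apply: DeriveDef => //; rewrite derive1E.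
  - move=> x xL; have [_ d2] := df _ xL; apply: DeriveDef => //.
    by rewrite -derive1E -(ddf _ xL) opprK.
pose w := k.+1%:R * pi / L.
have w0 : 0 < w by rewrite divr_gt0// mulr_gt0// pi_gt0.
pose F (x : R) := c * sin (w * x).
pose F1 (x : R) := c * (w * cos (w * x)).
have dwx (x : R) : is_derive x 1 (fun x : R => w * x) w.
  by apply: is_derive_eq; rewrite /GRing.scale/= mulr1.
have dF (x : R) : is_derive x 1 F (F1 x).
  have := is_derive1_comp (is_derive_sin (w * x)) (dwx x) => h.
  by apply: is_derive_eq; rewrite /GRing.scale/= /F1; ring.
have dF1 (x : R) : is_derive x 1 F1 (- (w ^+ 2 * F x)).
  have := is_derive1_comp (is_derive_cos (w * x)) (dwx x) => h.
  by apply: is_derive_eq; rewrite /GRing.scale/= /F; ring.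
have {}fE x : x \in `[0, L] -> f x = F x by move=> /fE ->; rewrite /dirichlet_mode; congr (_ * sin _); rewrite /w mulrAC.
have nearL x : x \in `]0, L[ -> \forall y \near x, y \in `]0, L[.
  by move=> xL; exact: near_in_itvoo.
have dfx x : x \in `]0, L[ -> is_derive x 1 f (F1 x).
  move=> xL; have : \forall y \near x, F y = f y; last first.
    by move=> Ff; exact: near_eq_is_derive Ff (dF x).
  near=> y; rewrite fE//; have : y \in `]0, L[ by near: y; exact: nearL.
  by rewrite !in_itv/= => /andP[/ltW-> /ltW->].
have ddfx x : x \in `]0, L[ -> is_derive x 1 (derive1 f) (- (w ^+ 2 * F x)).
  move=> xL; have : \forall y \near x, F1 y = derive1 f y; last first.
    by move=> Ff; exact: near_eq_is_derive Ff (dF1 x).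
  near=> y; have yL : y \in `]0, L[ by near: y; exact: nearL.
  by have h := dfx y yL; rewrite derive1E derive_val.
have sw : sin (w * L) = 0.
  rewrite /w mulfVK ?gt_eqF//; have := alternatingn (@sinDpi R) k.+1 0.
  by rewrite add0r mulr_natl sin0 mulr0.
split.
- have cF : {within `[0, L], continuous F}.
    by apply: derivable_within_continuous => x _; have [] := dF x.
  apply: subspace_eq_continuous cF => x; rewrite inE/= => xL.
  exact/esym/fE.
- rewrite !fE ?in_itv/= ?lexx ?(ltW L0)// /F mulr0 sin0 sw !mulr0.
  by [].
- have x0L : L / (2 * k.+1%:R) \in `]0, L[.
    rewrite in_itv/= divr_gt0//= ltr_pdivrMr// ltr_pMr// -natrM ltr1n.
    by rewrite mul2n.
  exists (L / (2 * k.+1%:R)) => //; rewrite fE; last first.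
    by move: x0L; rewrite !in_itv/= => /andP[/ltW-> /ltW->].
  rewrite /F (_ : w * _ = pi / 2) ?sin_pihalf ?mulr1//.
  by rewrite /w; field; rewrite (gt_eqF L0) /= nat1r pnatr_eq0.
- by move=> x xL; have [] := dfx x xL; have [] := ddfx x xL.
- move=> x xL; have h := ddfx x xL; rewrite derive1E derive_val opprK fE//.
  by move: xL; rewrite !in_itv/= => /andP[/ltW-> /ltW->].
Unshelve. all: by end_near. Qed.

End DirichletEigenfunctions.

Section L2_interval.
Context (R : realType) (L : R).

(* L^2(0, L) is realized as L^2 of the real line for the restriction of the
   Lebesgue measure to ]0, L[: values outside ]0, L[ are irrelevant. *)
Definition lebesgue_on :
    {measure set (measurableTypeR R) -> \bar R} :=
  mrestr (@lebesgue_measure R) (measurable_itv `]0, L[).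

Definition L2 := LspaceType2 lebesgue_on.

Definition L2_inner (f g : L2) : R := (\int[lebesgue_on]_x (f x * g x))%R.

Lemma L2_innerxx (f : L2) : L2_inner f f = `|f| ^+ 2.
Proof.
rewrite LspaceNormE unlock /L2_inner /Rintegral.
have f2 := Lfun2_integrable_sqr (repr_Lfun f).
have -> : (\int[lebesgue_on]_x (`|(EFin \o f) x| `^ 2))%E =
    (\int[lebesgue_on]_x (f x * f x)%:E)%E.
  by apply: eq_integral => x _; rewrite /= powR_mulrn// real_normK ?num_real// expr2.
have fi : (\int[lebesgue_on]_x (f x * f x)%:E)%E \is a fin_num.
  by apply: integrable_fin_num.
have f0 : (0 <= \int[lebesgue_on]_x (f x * f x)%:E)%E.
  by apply: integral_ge0 => x _; rewrite lee_fin -expr2 sqr_ge0.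
rewrite -(fineK fi) poweR_EFin /= -powR_mulrn ?powR_ge0// -powRrM mulVf//.
by rewrite powRr1// fine_ge0.
Qed.

Definition orthogonal_compl (E : set L2) : set L2 :=
  [set f | forall g, E g -> L2_inner f g = 0].

Fact bounded_L2 (f : R -> R) : measurable_fun [set: R] f ->
  (forall x, `|f x| <= 1) -> f \in Lfun lebesgue_on 2%:E.
Proof.
move=> mf f1; apply/andP; split; rewrite inE //=.
rewrite /finite_norm unlock; apply: poweR_lty.
apply: (@le_lt_trans _ _ (\int[lebesgue_on]_x (cst 1%E x))%E).
  apply: ge0_le_integral => //=.
  + apply/measurable_EFinP/(@measurableT_comp _ _ _ _ _ _ (@powR R ^~ 2)) => //.
    exact: measurableT_comp.
  + move=> x _; rewrite lee_fin; have /(congr1 (@^~ 2)) /= p12 := @powR1 R.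
    by rewrite -[leRHS]p12 ge0_ler_powR// nnegrE.
rewrite integral_cst// mul1e.
rewrite /lebesgue_on/= /mrestr setTI lebesgue_measure_itv /=.
by case: ifP => // _; rewrite -EFinD ltry.
Qed.

Fact indic_L2 (i : interval R) : \1_[set` i] \in Lfun lebesgue_on 2%:E.
Proof.
apply: bounded_L2 => [|x]; last first.
  by rewrite indicE; case: (_ \in _); rewrite ?normr1 ?normr0.
exact/measurable_indicP.
Qed.

Definition indicator (i : interval R) : L2 := Lspace_of (lee1n 2) (indic_L2 i).

Fact dirichlet_mode_L2 (k : nat) : dirichlet_mode L k \in Lfun lebesgue_on 2%:E.
Proof.
apply: bounded_L2 => [|x]; last by rewrite ler_norml sin_geN1 sin_le1.
apply: continuous_measurable_fun => x; rewrite /dirichlet_mode.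
apply: continuous_comp; last exact: continuous_sin.
by apply: cvgMl; apply: cvgMr.
Qed.

Definition eigenspan (M : nat) : set L2 :=
  lin_span (fun i : 'I_M => Lspace_of (lee1n 2) (dirichlet_mode_L2 i.+1) : L2).

Definition center (M j : nat) : R := j%:R * L / M.+1%:R.

Definition omega (r : R) (M j : nat) : interval R :=
  `]center M j - r * L / (2 * M%:R), center M j + r * L / (2 * M%:R)[.

Definition actuator_span (r : R) (M : nat) : set L2 :=
  lin_span (fun j : 'I_M => indicator (omega r M j.+1)).

End L2_interval.

Arguments eigenspan {R} L M.
Arguments center {R} L M j.
Arguments omega {R} L r M j.
Arguments actuator_span {R} L r M.

(* Main.v *)
(* Integrating a sine over an actuator gives <1_omega_j, s_i> = D_i S_ij, where
   s_i is the i-th Dirichlet mode, S_ij = sin(i j pi / (M+1)) is symmetric with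
   S S = (M+1)/2 (discrete sine transform), and
   D_i = (2L / (i pi)) sin(i pi r / (2M)). Hence the coefficients of the
   projection of f are S^-1 D^-1 (<f, s_i>)_i. Since the indicators are pairwise
   orthogonal with equal norms, and so are the modes, S is an isometry up to a
   scalar and the operator norm is a constant times max_i 1 / D_i. As sin x / x
   decreases on [0, pi/2], the maximum is attained at i = M. *)
Require Import Defs.
From mathcomp Require Import all_boot all_order all_algebra.
From mathcomp Require Import all_classical all_reals all_analysis.
From mathcomp Require Import measurable_realfun ring lra.
Import Order.TTheory GRing.Theory Num.Theory.
Import numFieldNormedType.Exports.
Local Open Scope classical_set_scope.
Local Open Scope ring_scope.

(** * Trigonometric sums over a regular grid *)

Lemma sin_natpi (R : realType) (n : nat) : sin (n%:R * pi) = 0 :> R.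
Proof.
by rewrite -[_ * pi]add0r mulr_natl (alternatingn (@sinDpi R)) sin0 mulr0.
Qed.

Lemma cos_natpi (R : realType) (n : nat) : cos (n%:R * pi) = (-1) ^+ n :> R.
Proof.
by rewrite -[_ * pi]add0r mulr_natl (alternatingn (@cosDpi R)) cos0 mulr1.
Qed.

Lemma sinM_sinE (R : realType) (x y : R) :
  sin x * sin y = (cos (x - y) - cos (x + y)) / 2.
Proof. by rewrite cosB cosD; field. Qed.

(* Dirichlet kernel: the sum telescopes after multiplication by [2 sin s]. *)
Lemma dirichlet_kernel (R : realType) (s : R) (n : nat) :
  2 * sin s * \sum_(j < n) cos (j%:R * (2 * s)) =
  sin ((2 * n%:R - 1) * s) + sin s.
Proof.
elim: n => [|n IH].
  by rewrite big_ord0 !mulr0 sub0r mulN1r sinN addNr.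
rewrite big_ord_recr/= mulrDr IH -[n.+1%:R]natr1.
have -> : (2 * (n%:R + 1) - 1) * s = n%:R * (2 * s) + s by ring.
have -> : (2 * n%:R - 1) * s = n%:R * (2 * s) - s by ring.
by rewrite sinB sinD; ring.
Qed.

(** With [s = m pi / (2 N)] the kernel identity has [(2 N - 1) s = m pi - s], so its right-hand side
    is [(1 - (-1)^m) sin s]. The range of [m] puts [s] in []0, pi[], where [2 sin s] can be
    cancelled. *)
Lemma sum_cos (R : realType) (N m : nat) : (0 < m < N.*2)%N ->
  \sum_(j < N) cos (m%:R * pi * (j%:R / N%:R)) = (odd m)%:R :> R.
Proof.
move=> /andP[m0 mN].
have N0 : (0 : R) < N%:R by rewrite ltr0n; case: N mN.
have m0' : (0 : R) < m%:R by rewrite ltr0n.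
have mN' : m%:R < 2 * N%:R :> R by rewrite -natrM ltr_nat mul2n.
pose s : R := m%:R * pi / (2 * N%:R).
have pi0 := @pi_gt0 R.
have s0 : 0 < sin s.
  apply: sin_gt0_pi; rewrite divr_gt0 ?mulr_gt0//=.
  by rewrite ltr_pdivrMr ?mulr_gt0// mulrC ltr_pM2l.
have -> : \sum_(j < N) cos (m%:R * pi * (j%:R / N%:R)) =
    \sum_(j < N) cos (j%:R * (2 * s)) :> R.
  by apply: eq_bigr => j _; congr cos; rewrite /s; field; rewrite gt_eqF.
have ss0 : 2 * sin s != 0 by rewrite mulf_neq0// gt_eqF.
apply: (mulfI ss0); rewrite dirichlet_kernel.
have -> : (2 * N%:R - 1) * s = m%:R * pi - s by rewrite /s; field; rewrite gt_eqF.
rewrite sinB sin_natpi cos_natpi -signr_odd.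
by case: (odd m); rewrite /= ?expr0 ?expr1 ?mulr1n ?mulr0n; ring.
Qed.

(** The product formula leaves half the difference of two cosine sums, of frequencies [i - k] and
    [i + k]. These have the same parity, so the sums cancel, except that for [i = k] the first one
    consists of [N] ones and the second one vanishes. *)
Lemma sine_orthogonality (R : realType) (N i k : nat) :
    (0 < i < N)%N -> (0 < k < N)%N ->
  \sum_(j < N) sin (i%:R * pi * (j%:R / N%:R)) * sin (k%:R * pi * (j%:R / N%:R))
    = (N%:R / 2) *+ (i == k) :> R.
Proof.
wlog ki : i k / (k <= i)%N.
  move=> H; have [/H//|/ltnW/H{}H] := leqP k i => hi hk.
  by rewrite eq_sym -H//; apply: eq_bigr => j _; rewrite mulrC.
move=> /andP[i0 iN] /andP[k0 kN].
have ik : (0 < i + k < N.*2)%N by rewrite addn_gt0 i0 -addnn -addSn leq_add // ltnW.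
under eq_bigr do rewrite sinM_sinE -mulrBl -mulrDl -mulrBl -mulrDl -natrD -natrB//.
rewrite -mulr_suml sumrB (sum_cos _ _ _ ik).
have [->|nik] := eqVneq i k.
  rewrite subnn addnn odd_double subr0 mulr1n; congr (_ / _).
  under eq_bigr do rewrite !mul0r cos0.
  by rewrite sumr_const card_ord.
have {}ki : (k < i)%N by rewrite ltn_neqAle eq_sym nik.
rewrite sum_cos; last by rewrite subn_gt0 ki (leq_ltn_trans (leq_subr _ _))// -addnn ltn_addr.
by rewrite oddB ?(ltnW ki)// oddD subrr mul0r mulr0n.
Qed.

(** * Decrease of [sin x / x] along the multiples of a fixed angle *)

(** Controls one step of the decrease of [sin (n a) / n]. By induction: the gap at [n + 1] is
    [cos a] times the gap at [n] plus terms that are nonnegative on [[0, pi/2]]. *)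
Lemma natmul_sin_cos_le (R : realType) (a : R) (n : nat) :
  0 <= a -> n%:R * a <= pi / 2 -> n%:R * sin a * cos (n%:R * a) <= sin (n%:R * a).
Proof.
have pi0 := @pi_gt0 R.
move=> a0; elim: n => [|n IH]; first by rewrite !mul0r sin0.
rewrite -[n.+1%:R]natr1 mulrDl mul1r => na.
have n0 : 0 <= n%:R * a by rewrite mulr_ge0.
have na' : n%:R * a <= pi / 2 by apply: le_trans na; rewrite lerDl.
have {}IH := IH na'.
have ha : 0 <= sin a by rewrite sin_ge0_pi// a0/=; nra.
have hna : 0 <= sin (n%:R * a) by rewrite sin_ge0_pi// n0/=; nra.
have cna : 0 <= cos (n%:R * a) by rewrite cos_ge0_pihalf// na' andbT; nra.
have c1 := cos_le1 a.
have c0 : 0 <= cos a by rewrite cos_ge0_pihalf//; apply/andP; split; nra.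
rewrite sinD cosD -subr_ge0.
have -> : sin (n%:R * a) * cos a + cos (n%:R * a) * sin a -
  (n%:R + 1) * sin a * (cos (n%:R * a) * cos a - sin (n%:R * a) * sin a) =
  cos a * (sin (n%:R * a) - n%:R * sin a * cos (n%:R * a)) +
  cos (n%:R * a) * sin a * (1 - cos a) +
  (n%:R + 1) * sin a ^+ 2 * sin (n%:R * a) by ring.
by rewrite !addr_ge0 ?mulr_ge0 ?subr_ge0 ?sqr_ge0 ?addr_ge0.
Qed.

(* A discrete form of the monotonicity of [sin x / x] on [0, pi/2]. *)
Lemma natmul_sin_le (R : realType) (a : R) (m n : nat) : 0 <= a -> (m <= n)%N ->
  n%:R * a <= pi / 2 -> m%:R * sin (n%:R * a) <= n%:R * sin (m%:R * a).
Proof.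
have pi0 := @pi_gt0 R.
move=> a0; elim: n => [|n IH]; first by rewrite leqn0 => /eqP->.
rewrite leq_eqVlt => /orP[/eqP->//|]; rewrite ltnS => mn.
rewrite -[n.+1%:R]natr1 mulrDl mul1r => na.
have n0 : 0 <= n%:R * a by rewrite mulr_ge0.
have na' : n%:R * a <= pi / 2 by apply: le_trans na; rewrite lerDl.
have {}IH := IH mn na'.
have hna : 0 <= sin (n%:R * a) by rewrite sin_ge0_pi// n0/=; nra.
have c1 := cos_le1 a.
have [n00|npos] := posnP n.
  by move: mn; rewrite n00 leqn0 => /eqP->; rewrite !mul0r sin0 mulr0.
have npos' : (0 : R) < n%:R by rewrite ltr0n.
(* The case [m = n] of the passage to [n + 1]. Adding [m] times this inequality to [n + 1] times the
   induction hypothesis gives the goal multiplied by [n], which is why [n = 0] is treated apart. *)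
have step : n%:R * sin (n%:R * a + a) <= (n%:R + 1) * sin (n%:R * a).
  have := natmul_sin_cos_le R a n a0 na'.
  rewrite sinD -subr_ge0 => h; rewrite -subr_ge0.
  have -> : (n%:R + 1) * sin (n%:R * a) -
    n%:R * (sin (n%:R * a) * cos a + cos (n%:R * a) * sin a) =
    n%:R * sin (n%:R * a) * (1 - cos a) +
    (sin (n%:R * a) - n%:R * sin a * cos (n%:R * a)) by ring.
  by rewrite addr_ge0// !mulr_ge0// subr_ge0.
rewrite -(ler_pM2l npos').
have m0 : (0 : R) <= m%:R by [].
have := ler_wpM2l m0 step; have n1 : (0 : R) <= n%:R + 1 by rewrite addr_ge0.
have := ler_wpM2l n1 IH.
lra.
Qed.

(** * Oblique projections for an abstract inner product *)

Section ObliqueProjectionNorm.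
Context (R : realType) (V : normedModType R) (ip : V -> V -> R).
Hypothesis ipC : forall u v, ip u v = ip v u.
Hypothesis ip_linear : forall a u v w, ip (a *: u + v) w = a * ip u w + ip v w.
Hypothesis ipxx : forall u, ip u u = `|u| ^+ 2.

Lemma ip0l w : ip 0 w = 0.
Proof. by have := ip_linear (-1) 0 0 w; rewrite scaler0 addr0; lra. Qed.

Lemma ipDl u v w : ip (u + v) w = ip u w + ip v w.
Proof. by rewrite -[u in LHS]scale1r ip_linear mul1r. Qed.

Lemma ipZl a u w : ip (a *: u) w = a * ip u w.
Proof. by rewrite -[a *: u in LHS]addr0 ip_linear ip0l addr0. Qed.

Lemma ipBl u v w : ip (u - v) w = ip u w - ip v w.
Proof. by rewrite ipDl -scaleN1r ipZl mulN1r. Qed.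

Lemma ip_suml n (F : 'I_n -> V) w : ip (\sum_i F i) w = \sum_i ip (F i) w.
Proof. exact: (big_morph (ip^~ w) (fun u v => ipDl u v w) (ip0l w)). Qed.

Lemma ip_lin_comb n (e : 'I_n -> V) (a : 'I_n -> R) c k :
  (forall i j, ip (e i) (e j) = c *+ (i == j)) ->
  ip (\sum_i a i *: e i) (e k) = a k * c.
Proof.
move=> ee; rewrite ip_suml (bigD1 k)//= ipZl ee eqxx mulr1n big1 ?addr0//.
by move=> i /negbTE ik; rewrite ipZl ee ik mulr0n mulr0.
Qed.

Lemma norm_lin_comb n (e : 'I_n -> V) (a : 'I_n -> R) c :
  (forall i j, ip (e i) (e j) = c *+ (i == j)) ->
  `|\sum_i a i *: e i| ^+ 2 = c * \sum_i a i ^+ 2.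
Proof.
move=> ee; rewrite -ipxx ip_suml mulr_sumr; apply: eq_bigr => i _.
by rewrite ipZl ipC (ip_lin_comb _ _ _ _ _ ee); ring.
Qed.

(** Expand [|f - p|^2 >= 0], where [p] is the orthogonal projection of [f] onto the span of [e], so
    that [<p, f> = |p|^2]. The factor [c] appears because the family is orthogonal but not
    normalized. *)
Lemma bessel n (e : 'I_n -> V) c f : 0 < c ->
  (forall i j, ip (e i) (e j) = c *+ (i == j)) ->
  \sum_i ip f (e i) ^+ 2 <= c * `|f| ^+ 2.
Proof.
move=> c0 ee; pose p := \sum_i (ip f (e i) / c) *: e i.
have pp : `|p| ^+ 2 = (\sum_i ip f (e i) ^+ 2) / c.
  rewrite (norm_lin_comb _ _ _ _ ee) mulr_sumr mulr_suml; apply: eq_bigr => i _.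
  by field; rewrite gt_eqF.
have pf : ip p f = `|p| ^+ 2.
  rewrite pp ip_suml mulr_suml; apply: eq_bigr => i _.
  by rewrite ipZl (ipC (e i)); field; rewrite gt_eqF.
have : 0 <= `|f - p| ^+ 2 by rewrite sqr_ge0.
rewrite -ipxx ipBl (ipC f) (ipC p) !ipBl !ipxx (ipC f) pf subrr subr0 subr_ge0 pp.
by rewrite ler_pdivrMr// mulrC.
Qed.

(** Cauchy-Schwarz, as Bessel's inequality for the single vector [v]. *)
Lemma normr_ip_le u v : `|ip u v| <= `|u| * `|v|.
Proof.
have [->|v0] := eqVneq v 0; first by rewrite ipC ip0l !normr0 mulr0.
have vv : 0 < `|v| ^+ 2 by rewrite exprn_gt0// normr_gt0.
have h := @bessel 1 (fun=> v) _ u vv.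
rewrite -ler_sqr ?nnegrE ?mulr_ge0// exprMn real_normK ?num_real//.
move: h; rewrite big_ord1 mulrC; apply => i j.
by rewrite ipxx !ord1 eqxx.
Qed.

(** Serves for both summands: an orthogonal complement is an intersection of zero sets of [ip^~ g],
    and the span of [u] is the zero set of [|x - P x|]. The radius uses [|k| + 1] to have a positive
    denominator. *)
Lemma closed_zero_lipschitz (g : V -> R) k :
  (forall x y, `|g x - g y| <= k * `|x - y|) -> closed [set x | g x = 0].
Proof.
move=> gk x xcl; apply/eqP; rewrite -normr_eq0 eq_le normr_ge0 andbT.
apply/ler_addgt0Pl => e e0; rewrite addr0.
have k1 : 0 < `|k| + 1 by rewrite ltr_wpDl.
have [y [/= gy0]] := xcl _ (nbhsx_ballx x (e / (`|k| + 1)) (divr_gt0 e0 k1)).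
rewrite -ball_normE/= => xy.
have := gk x y; rewrite gy0 subr0 => /le_trans; apply.
apply: (@le_trans _ _ ((`|k| + 1) * `|x - y|)).
  by rewrite ler_wpM2r// (le_trans (ler_norm k))// lerDl.
by rewrite mulrC -ler_pdivlMr// ltW.
Qed.

Definition ip_compl (E : set V) : set V := [set f | forall g, E g -> ip f g = 0].

Lemma closed_ip_compl E : closed (ip_compl E).
Proof.
move=> f fcl g Eg.
apply: (@closed_zero_lipschitz (ip^~ g) `|g|).
  by move=> x y; rewrite -ipBl mulrC normr_ip_le.
by apply: closureS fcl => h; exact.
Qed.

Lemma subspace_ip_compl E : is_subspace (ip_compl E).
Proof.
split=> [g _|a u v uE vE g Eg]; first exact: ip0l.
by rewrite ip_linear uE// vE// mulr0 addr0.
Qed.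

Lemma ip_compl_lin_span n (e : 'I_n -> V) f :
  ip_compl (lin_span e) f <-> forall i, ip f (e i) = 0.
Proof.
split=> [fE i|fe _ [a _ <-]].
  apply: fE; exists (fun j => (j == i)%:R) => //.
  rewrite (bigD1 i)//= eqxx scale1r big1 ?addr0// => j /negbTE ->.
  by rewrite scale0r.
rewrite ipC ip_suml big1// => i _.
by rewrite ipZl ipC fe mulr0.
Qed.

Lemma subspace_lin_span n (u : 'I_n -> V) : is_subspace (lin_span u).
Proof.
split; first by exists (fun=> 0) => //; rewrite big1// => i _; rewrite scale0r.
move=> a _ _ [b _ <-] [b' _ <-]; exists (fun i => a * b i + b' i) => //.
rewrite scaler_sumr -big_split/=; apply: eq_bigr => i _.
by rewrite scalerDl scalerA.
Qed.

(** * The projection for two orthogonal families with cross Gram matrix [D_i S_ij] *)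

Context (n : nat) (u e : 'I_n -> V) (c d sigma : R) (D : 'I_n -> R).
Context (S : 'I_n -> 'I_n -> R).
Hypotheses (c0 : 0 < c) (d0 : 0 < d) (sigma0 : 0 < sigma).
Hypothesis ee : forall i k, ip (e i) (e k) = c *+ (i == k).
Hypothesis uu : forall j l, ip (u j) (u l) = d *+ (j == l).
Hypothesis ue : forall j i, ip (u j) (e i) = D i * S i j.
Hypothesis SC : forall i j, S i j = S j i.
Hypothesis SS : forall i k, \sum_j S i j * S k j = sigma *+ (i == k).
Context (m : 'I_n).
Hypotheses (Dm0 : 0 < D m) (Dm : forall i, D m <= D i).

Let D0 i : D i != 0. Proof. by rewrite gt_eqF// (lt_le_trans Dm0). Qed.

(* The coefficients solve [<P f, e_k> = <f, e_k>]; the matrix [D_i S_ij] of this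
   system is inverted through [S^-1 = S / sigma]. *)
Let coef f j := sigma^-1 * \sum_i S j i * (ip f (e i) / D i).
Let P f := \sum_j coef f j *: u j.

(** This makes [f - P f] orthogonal to every [e k]. After exchanging the sums, orthogonality of the
    rows of [S] keeps only [i = k], where [D k] and [sigma] cancel. *)
Let ipP f k : ip (P f) (e k) = ip f (e k).
Proof.
rewrite ip_suml; transitivity (\sum_j \sum_i
    (S k j * S i j) * (D k / sigma * (ip f (e i) / D i))).
  apply: eq_bigr => j _; rewrite ipZl ue /coef mulr_sumr mulr_suml.
  by apply: eq_bigr => i _; rewrite (SC j i); ring.
rewrite exchange_big/= (bigD1 k)//= -mulr_suml SS eqxx mulr1n big1 => [|i ik].
  by rewrite addr0; field; rewrite D0 gt_eqF.
by rewrite -mulr_suml SS eq_sym (negbTE ik) mulr0n mul0r.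
Qed.

Let P_linear a f g : P (a *: f + g) = a *: P f + P g.
Proof.
rewrite /P scaler_sumr -big_split/=; apply: eq_bigr => j _.
rewrite scalerA -scalerDl; congr (_ *: _).
rewrite /coef mulrCA -mulrDr; congr (_ * _); rewrite mulr_sumr -big_split/=.
by apply: eq_bigr => i _; rewrite ip_linear; ring.
Qed.

Let PB f g : P (f - g) = P f - P g.
Proof. by rewrite addrC -[- g]scaleN1r P_linear scaleN1r addrC. Qed.

(** The inverse matrix now acts on the other side. The sum over [i] is again a product of two rows
    of [S] because [S] is symmetric. *)
Let P_U f : lin_span u f -> P f = f.
Proof.
move=> [a _ <-]; rewrite /P; apply: eq_bigr => l _; congr (_ *: _).
rewrite /coef; transitivity (sigma^-1 * \sum_i \sum_j (S l i * S j i) * a j).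
  congr (_ * _); apply: eq_bigr => i _; rewrite ip_suml mulr_suml mulr_sumr.
  by apply: eq_bigr => j _; rewrite ipZl ue (SC i j); field; exact: D0.
rewrite exchange_big/= (bigD1 l)//= -mulr_suml SS eqxx mulr1n big1 => [|j jl].
  by rewrite addr0 mulKf// gt_eqF.
by rewrite -mulr_suml SS eq_sym (negbTE jl) mulr0n mul0r.
Qed.

(** Parseval twice: for the orthogonal family [u], then for [S], which multiplies sums of squares by
    [sigma]. Together with the [sigma^-2] coming from [coef], this leaves [1 / sigma]. *)
Let normP f : `|P f| ^+ 2 = d / sigma * \sum_i (ip f (e i) / D i) ^+ 2.
Proof.
rewrite (norm_lin_comb _ _ _ _ uu) -mulrA; congr (_ * _).
rewrite /coef; under eq_bigr => j _ do rewrite exprMn.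
rewrite -mulr_sumr.
suff -> : \sum_j (\sum_i S j i * (ip f (e i) / D i)) ^+ 2 =
    sigma * \sum_i (ip f (e i) / D i) ^+ 2.
  by field; rewrite gt_eqF.
transitivity (\sum_j \sum_i \sum_k
    (S i j * S k j) * ((ip f (e i) / D i) * (ip f (e k) / D k))).
  apply: eq_bigr => j _; rewrite expr2 mulr_suml; apply: eq_bigr => i _.
  rewrite mulr_sumr; apply: eq_bigr => k _; rewrite (SC j i) (SC j k).
  by ring.
rewrite exchange_big/= mulr_sumr; apply: eq_bigr => i _.
rewrite exchange_big/= (bigD1 i)//= -mulr_suml SS eqxx mulr1n big1 => [|k ki].
  by rewrite addr0 expr2.
by rewrite -mulr_suml SS eq_sym (negbTE ki) mulr0n mul0r.
Qed.

(** The norm to be reached: [d / sigma] comes from [normP], [c] from Bessel's inequality, and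
    [1 / D m] is the largest of the [1 / D i]. *)
Let K := Num.sqrt (c * d / sigma) / D m.

Let K0 : 0 <= K. Proof. by rewrite divr_ge0// ltW. Qed.

Let K2 : K ^+ 2 = c * d / sigma / D m ^+ 2.
Proof. by rewrite exprMn exprVn sqr_sqrtr// ltW// divr_gt0// mulr_gt0. Qed.

Let P_le f : `|P f| <= K * `|f|.
Proof.
rewrite -ler_sqr ?nnegrE ?(mulr_ge0 K0)// exprMn normP K2.
apply: (@le_trans _ _ (d / sigma * \sum_i (ip f (e i) ^+ 2 / D m ^+ 2))).
  rewrite ler_pM2l ?divr_gt0//; apply: ler_sum => i _.
  rewrite [(_ / _) ^+ 2]exprMn exprVn ler_wpM2l ?sqr_ge0// lef_pV2 ?posrE ?exprn_gt0//.
  - by rewrite ler_sqr ?nnegrE// ?(ltW (lt_le_trans Dm0 _))// ltW.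
  - exact: lt_le_trans (Dm i).
rewrite -mulr_suml.
have := bessel _ _ _ f c0 ee => h.
rewrite [leRHS](_ : _ = d / sigma * ((c * `|f| ^+ 2) / D m ^+ 2)); last first.
  by field; rewrite (gt_eqF Dm0) gt_eqF.
by rewrite ler_pM2l ?divr_gt0// ler_pM2r// invr_gt0 exprn_gt0.
Qed.

(** The extremal vector: only the term [i = m] survives in [normP], and Bessel's inequality is an
    equality at [e m]. *)
Let P_em : `|P (e m)| = K * `|e m|.
Proof.
apply/eqP; rewrite -(@eqrXn2 _ 2)// ?(mulr_ge0 K0)// exprMn K2 normP -ipxx ee eqxx mulr1n.
rewrite (bigD1 m)//= ee eqxx mulr1n big1 => [|i im].
  by apply/eqP; field; rewrite (gt_eqF Dm0) gt_eqF.
by rewrite ee eq_sym (negbTE im) mulr0n mul0r expr0n.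
Qed.

(** Uniqueness of the decomposition: [P] fixes the span of [u] and vanishes on the complement of the
    span of [e]. *)
Let decomp x y z : lin_span u y -> ip_compl (lin_span e) z -> x = y + z -> y = P x.
Proof.
move=> uy /ip_compl_lin_span ze ->.
have Pz : P z = 0.
  rewrite /P big1// => j _; rewrite /coef big1 ?mulr0 ?scale0r// => i _.
  by rewrite ze mul0r mulr0.
by rewrite -[y + z]/(y + z) -[y in RHS]scale1r P_linear P_U// Pz addr0 scale1r.
Qed.

Let UP x : lin_span u (P x). Proof. by exists (coef x). Qed.

Let Pcompl x : ip_compl (lin_span e) (x - P x).
Proof. by apply/ip_compl_lin_span => i; rewrite ipBl ipP subrr. Qed.

Lemma direct_sum_ip_compl : direct_sum (lin_span u) (ip_compl (lin_span e)).
Proof.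
split; first split; first exact: subspace_lin_span.
(* The span of [u] is the set of fixed points of [P], and [x - P x] is Lipschitz with constant
   [1 + K] by [P_le]. *)
- rewrite (_ : lin_span u = [set x | `|x - P x| = 0]); last first.
    apply/seteqP; split=> x /=; first by move/P_U->; rewrite subrr normr0.
    by move/normr0_eq0/eqP; rewrite subr_eq0 => /eqP ->.
  apply: (@closed_zero_lipschitz _ (1 + K)) => x y.
  apply: le_trans (ler_dist_dist _ _) _.
  have -> : x - P x - (y - P y) = (x - y) - P (x - y).
    by rewrite PB !opprB addrACA [RHS]addrACA [- y - P x]addrC.
  by rewrite (le_trans (ler_normB _ _))// mulrDl mul1r lerD2l.
- by split; [exact: subspace_ip_compl|exact: closed_ip_compl].
- move=> x; exists (P x, x - P x); split=> /=.
    by split; [exact: UP|exact: Pcompl|rewrite addrC subrK].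
  case=> y z /= [uy ez xyz]; have yP := decomp x y z uy ez xyz.
  by rewrite -yP [X in X - _]xyz addrC addKr.
Qed.

Let oblique_projE x : oblique_proj (lin_span u) (ip_compl (lin_span e)) x = P x.
Proof.
rewrite /oblique_proj; apply: xget_unique.
  by split; [exact: UP|exists (x - P x); [exact: Pcompl|rewrite addrC subrK]].
by move=> y [uy [z ez xyz]]; exact: decomp ez xyz.
Qed.

Lemma opnorm_oblique_proj :
  opnorm (oblique_proj (lin_span u) (ip_compl (lin_span e))) =
  (Num.sqrt (c * d / sigma) / D m)%:E.
Proof.
apply/eqP; rewrite eq_le; apply/andP; split.
  apply: ge_ereal_sup => _ [x /= x1 <-]; rewrite oblique_projE lee_fin.
  by rewrite (le_trans (P_le x))// ler_piMr.
apply: ereal_sup_ubound; have em0 : 0 < `|e m|.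
  rewrite normr_gt0; apply: contraTneq c0 => em.
  by have := ee m m; rewrite em ip0l eqxx mulr1n => <-; rewrite ltxx.
(* The supremum is attained at the normalized extremal vector; [e m] is nonzero since [c > 0]. *)
exists (`|e m|^-1 *: e m) => /=.
  by rewrite normrZ normfV normr_id mulVf// gt_eqF.
rewrite oblique_projE; have -> : P (`|e m|^-1 *: e m) = `|e m|^-1 *: P (e m).
  have P0 : P 0 = 0 by rewrite -[X in P X](subrr 0) PB subrr.
  by rewrite -[_ *: e m]addr0 P_linear P0 addr0.
by rewrite normrZ normfV normr_id P_em mulrCA mulVf ?mulr1// gt_eqF.
Qed.

End ObliqueProjectionNorm.

(** * Inner products of square-integrable classes through representatives *)

Section LspaceType2_product.
Context d (T : measurableType d) (R : realType) (mu : {measure set T -> \bar R}).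
Implicit Types f g h : LspaceType2 mu.

Lemma Lspace_mul_integrable f g :
  mu.-integrable setT (EFin \o (fun x => f x * g x)).
Proof. by apply/Lfun1_integrable; apply: Lfun2_mul_Lfun1; exact: repr_Lfun. Qed.

Lemma ae_eq_Rintegral (u v : T -> R) :
  mu.-integrable setT (EFin \o u) -> mu.-integrable setT (EFin \o v) ->
  u = v %[ae mu] -> \int[mu]_x u x = \int[mu]_x v x.
Proof.
move=> iu iv uv; rewrite /Rintegral; congr fine.
apply: ae_eq_integral => //.
- exact: measurable_int iu.
- exact: measurable_int iv.
- by apply: filterS uv => x /= h _; rewrite h.
Qed.

(** The operations on classes agree with the pointwise ones only almost everywhere, so the integrand
    is replaced before linearity of the integral applies. *)
Lemma Rintegral_Lspace_linear a f g h :
  \int[mu]_x ((a *: f + g : LspaceType2 mu) x * h x) =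
  a * \int[mu]_x (f x * h x) + \int[mu]_x (g x * h x).
Proof.
have i1 := Lspace_mul_integrable f h; have i2 := Lspace_mul_integrable g h.
have i3 : mu.-integrable setT (EFin \o (fun x => a * (f x * h x))).
  have := integrableZl measurableT a i1.
  by apply: eq_integrable => // x _ /=; rewrite EFinM.
rewrite -RintegralZl// -RintegralD//; apply: ae_eq_Rintegral.
- exact: Lspace_mul_integrable.
- have := integrableD measurableT i3 i2.
  by apply: eq_integrable => // x _ /=; rewrite EFinD.
- apply: filterS2 (LspaceD (a *: f) g) (LspaceZ a f) => x /= h1 h2 _.
  by rewrite h1// h2//; ring.
Qed.

Lemma Rintegral_Lspace_of (u v : T -> R)
    (uP : u \in Lfun mu 2%:E) (vP : v \in Lfun mu 2%:E) :
  \int[mu]_x (Lspace_of (lee1n 2) uP x * Lspace_of (lee1n 2) vP x) =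
  \int[mu]_x (u x * v x).
Proof.
apply: ae_eq_Rintegral; first exact: Lspace_mul_integrable.
- exact/Lfun1_integrable/Lfun2_mul_Lfun1.
- apply: filterS2 (Lspace_ofE (lee1n 2) uP) (Lspace_ofE (lee1n 2) vP) => x /= h1 h2 _.
  by rewrite h1// h2.
Qed.

Lemma Rintegral_mrestr (D : set T) (mD : measurable D) (u : T -> R) :
  (mrestr mu mD).-integrable setT (EFin \o u) ->
  \int[mrestr mu mD]_x u x = \int[mu]_(x in D) u x.
Proof.
move=> iu; rewrite /Rintegral; congr fine.
(* The complement of [D] is null for the restricted measure, and the two measures agree on subsets
   of [D]. *)
rewrite (negligible_integral (N := ~` D))//.
- rewrite setTD setCK; apply: eq_measure_integral => A mA /setIidl AI.
  by rewrite /= /mrestr AI.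
- exact: measurableC.
- by rewrite /= /mrestr setICl measure0.
Qed.

End LspaceType2_product.

Section L2_inner_theory.
Context (R : realType) (L : R).
Implicit Types f g h : L2 L.

Lemma L2_innerC f g : L2_inner f g = L2_inner g f.
Proof. by rewrite /L2_inner; under eq_Rintegral do rewrite mulrC. Qed.

Lemma L2_inner_linear a f g h :
  L2_inner (a *: f + g) h = a * L2_inner f h + L2_inner g h.
Proof. exact: Rintegral_Lspace_linear. Qed.

Lemma L2_inner_Lspace_of (u v : R -> R)
    (uP : u \in Lfun (lebesgue_on L) 2%:E) (vP : v \in Lfun (lebesgue_on L) 2%:E) :
  L2_inner (Lspace_of (lee1n 2) uP : L2 L) (Lspace_of (lee1n 2) vP) =
  \int[@lebesgue_measure R]_(x in `]0, L[) (u x * v x).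
Proof.
rewrite /L2_inner Rintegral_Lspace_of; apply: Rintegral_mrestr.
exact/Lfun1_integrable/Lfun2_mul_Lfun1.
Qed.

End L2_inner_theory.

(** * Integrals of sines over open intervals *)

Section integrals.
Context (R : realType).
Implicit Types a b w x : R.

Lemma Rintegral_oo_FTC2 (F f : R -> R) a b : a < b ->
  (forall x : R, is_derive x 1 F (f x)) -> continuous f ->
  \int[@lebesgue_measure R]_(x in `]a, b[) f x = F b - F a.
Proof.
move=> ab dF cf.
have cF : continuous F.
  by move=> x; apply: differentiable_continuous; apply/derivable1_diffP; have [] := dF x.
rewrite /Rintegral -(@integral_itv_bndoo _ a b _ true false).
- rewrite (continuous_FTC2 ab (F := F)) //.
  + exact: continuous_subspaceT.
  + split; first by move=> x _; have [] := dF x.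
    * by apply: cvg_at_right_filter; exact: cF.
    * by apply: cvg_at_left_filter; exact: cF.
  + by move=> x _; rewrite derive1E; have [_ ->] := dF x.
- apply/measurable_EFinP; apply: measurable_funTS.
  exact: continuous_measurable_fun.
Qed.

Lemma is_derive_sinM w x : is_derive x 1 (fun x : R => sin (w * x)) (w * cos (w * x)).
Proof.
have h : is_derive x 1 (fun x : R => w * x) w.
  by apply: is_derive_eq; rewrite /GRing.scale/= mulr1.
by apply: is_derive_eq (is_derive1_comp _ h) _; rewrite /GRing.scale/= mulrC.
Qed.

Lemma is_derive_cosM w x : is_derive x 1 (fun x : R => cos (w * x)) (- w * sin (w * x)).
Proof.
have h : is_derive x 1 (fun x : R => w * x) w.
  by apply: is_derive_eq; rewrite /GRing.scale/= mulr1.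
by apply: is_derive_eq (is_derive1_comp _ h) _; rewrite /GRing.scale/=; ring.
Qed.

Lemma continuous_sinM w : continuous (fun x : R => sin (w * x)).
Proof.
move=> x; apply: differentiable_continuous; apply/derivable1_diffP.
by have [] := is_derive_sinM w x.
Qed.

Lemma Rintegral_sinM w a b : w != 0 -> a < b ->
  \int[@lebesgue_measure R]_(x in `]a, b[) sin (w * x) =
  (cos (w * a) - cos (w * b)) / w.
Proof.
move=> w0 ab.
have dF x : is_derive x 1 (fun x => - w^-1 * cos (w * x)) (sin (w * x)).
  have := is_derive_cosM w x => h.
  by apply: is_derive_eq; rewrite /GRing.scale/=; field.
by rewrite (Rintegral_oo_FTC2 _ _ _ _ ab dF (continuous_sinM w)); field.
Qed.

(** Each case has an explicit antiderivative, with [x / 2] in place of the [w - v] term when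
    [w = v]. All sine terms vanish at [0] and [L]. *)
Lemma Rintegral_sin_sin (L w v : R) : 0 < L -> w + v != 0 ->
    sin (w * L) = 0 -> sin (v * L) = 0 ->
  \int[@lebesgue_measure R]_(x in `]0, L[) (sin (w * x) * sin (v * x)) =
  (L / 2) *+ (w == v).
Proof.
move=> L0 wv swL svL.
have csc : continuous (fun x : R => sin (w * x) * sin (v * x)).
  by move=> x; apply: cvgM; exact: continuous_sinM.
have swvL : sin ((w + v) * L) = 0 by rewrite mulrDl sinD swL svL mul0r mulr0 addr0.
have [wv_eq|wv_neq] := eqVneq w v.
  have dF x : is_derive x 1 (fun x => x / 2 - sin ((w + v) * x) / (2 * (w + v)))
      (sin (w * x) * sin (v * x)).
    have := is_derive_sinM (w + v) x => h.
    apply: is_derive_eq; rewrite sinM_sinE -mulrBl -mulrDl wv_eq subrr mul0r cos0.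
    by rewrite /GRing.scale/=; field; rewrite -{1}wv_eq.
  by rewrite (Rintegral_oo_FTC2 _ _ _ _ L0 dF csc) swvL mulr0 sin0 !mul0r !subr0 mulr1n.
have wBv : w - v != 0 by rewrite subr_eq0.
have swBL : sin ((w - v) * L) = 0 by rewrite mulrBl sinB swL svL mul0r mulr0 subr0.
have dF x : is_derive x 1
    (fun x => sin ((w - v) * x) / (2 * (w - v)) - sin ((w + v) * x) / (2 * (w + v)))
    (sin (w * x) * sin (v * x)).
  have := is_derive_sinM (w + v) x => h; have := is_derive_sinM (w - v) x => h'.
  apply: is_derive_eq; rewrite sinM_sinE -mulrBl -mulrDl.
  by rewrite /GRing.scale/=; field; rewrite wv wBv.
rewrite (Rintegral_oo_FTC2 _ _ _ _ L0 dF csc) swvL swBL !mulr0 sin0.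
by rewrite !mul0r !subr0 mulr0n.
Qed.

Lemma Rintegral_indicM (A B : set R) (f : R -> R) : A `<=` B ->
  \int[@lebesgue_measure R]_(x in B) (\1_A x * f x) =
  \int[@lebesgue_measure R]_(x in A) f x.
Proof.
move=> AB; rewrite -[in RHS](setIidr AB) Rintegral_mkcondr.
apply: eq_Rintegral => x _; rewrite patchE indicE.
by case: (x \in A); rewrite ?mul1r ?mul0r.
Qed.

End integrals.

(** * Gram matrices of the actuators and the Dirichlet modes *)

Section actuators.
Context (R : realType) (L r : R) (M : nat).
Hypotheses (L0 : 0 < L) (r01 : 0 < r < 1) (M0 : (0 < M)%N).
Hypothesis rM : r / (1 - r) <= M%:R.

Let mode k : L2 L := Lspace_of (lee1n 2) (dirichlet_mode_L2 L k).
Let freq k : R := k%:R * pi / L.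
Let h := r * L / (2 * M%:R).

Let r0 : 0 < r. Proof. by case/andP: r01. Qed.
Let r1 : r < 1. Proof. by case/andP: r01. Qed.
Let MR0 : (0 : R) < M%:R. Proof. by rewrite ltr0n. Qed.
Let h0 : 0 < h. Proof. by rewrite divr_gt0 ?mulr_gt0. Qed.

Let dirichlet_modeE k : dirichlet_mode L k = fun x => sin (freq k * x).
Proof. by apply/funext => x; rewrite /dirichlet_mode /freq mulrAC. Qed.

Let freq_gt0 k : (0 < k)%N -> 0 < freq k.
Proof. by move=> k0; rewrite divr_gt0// mulr_gt0 ?pi_gt0// ltr0n. Qed.

Let sin_freqL k : sin (freq k * L) = 0.
Proof. by rewrite /freq divfK ?gt_eqF// sin_natpi. Qed.

Lemma inner_mode i k : (0 < i)%N -> (0 < k)%N ->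
  L2_inner (mode i) (mode k) = (L / 2) *+ (i == k).
Proof.
move=> i0 k0; rewrite L2_inner_Lspace_of !dirichlet_modeE Rintegral_sin_sin//.
  congr (_ *+ nat_of_bool _); rewrite /freq.
  have pL : pi / L != 0 by rewrite mulf_neq0 ?invr_eq0 ?gt_eqF ?pi_gt0.
  by rewrite -!mulrA (inj_eq (mulIf pL)) eqr_nat.
by rewrite gt_eqF// addr_gt0 ?freq_gt0.
Qed.

(* The hypothesis [r / (1 - r) <= M] says that the width [2h] of an actuator is
   at most the distance [L / (M + 1)] between neighbouring centers. *)
Let width : 2 * h <= L / M.+1%:R.
Proof.
have M1 : (0 : R) < M.+1%:R by rewrite ltr0n.
move: rM; rewrite ler_pdivrMr ?subr_gt0// => rM'.
rewrite /h ler_pdivlMr// -subr_ge0.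
have -> : L - 2 * (r * L / (2 * M%:R)) * M.+1%:R =
    L / M%:R * (M%:R * (1 - r) - r).
  by rewrite -[M.+1%:R]natr1; field; rewrite gt_eqF.
by rewrite mulr_ge0 ?subr_ge0// divr_ge0// ltW.
Qed.

Let centerS j : Defs.center L M j.+1 = Defs.center L M j + L / M.+1%:R.
Proof. by rewrite /Defs.center -[j.+1%:R]natr1 mulrDl mul1r mulrDl. Qed.

Let center_le i j : (i <= j)%N -> Defs.center L M i <= Defs.center L M j.
Proof.
by move=> ij; rewrite /Defs.center ler_pM2r ?invr_gt0 ?ltr0n// ler_pM2r// ler_nat.
Qed.

Lemma omega_sub j : (j < M)%N -> [set` omega L r M j.+1] `<=` `]0, L[%classic.
Proof.
move=> jM x; rewrite /omega /= -/h !in_itv/= => /andP[h1 h2].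
have := centerS j; have := center_le 0 j (leq0n j).
have := center_le _ _ jM; have := centerS M.
(* The formula for the centers extended to the indices [0] and [M + 1] gives the endpoints [0] and
   [L]. So every center is at least [L / (M + 1)] away from both endpoints, while [h] is at most
   half of that. *)
have -> : Defs.center L M 0 = 0 by rewrite /Defs.center !mul0r.
have -> : Defs.center L M M.+1 = L by rewrite /Defs.center mulrC mulKf// pnatr_eq0.
have := centerS j.+1.
have := h0; have := width; move: h1 h2.
move: (L / _) => d *; apply/andP; split; lra.
Qed.

Let omega_disjoint i j x : (i < j)%N ->
  x \in [set` omega L r M i.+1] -> x \in [set` omega L r M j.+1] -> False.
Proof.
move=> ij; rewrite !inE/= /omega -/h !in_itv/= => /andP[h1 h2] /andP[h3 h4].
have := center_le i.+1 j ij; have := centerS j; have := width.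
by move: (L / _) => d *; lra.
Qed.

Lemma inner_indicator (i j : 'I_M) :
  L2_inner (indicator L (omega L r M i.+1)) (indicator L (omega L r M j.+1)) =
  (r * L / M%:R) *+ (i == j).
Proof.
rewrite L2_inner_Lspace_of Rintegral_indicM; last exact: omega_sub.
have [<-|ij] := eqVneq i j.
  rewrite (@eq_Rintegral _ _ _ _ _ (cst 1)); last first.
    by move=> x xi; rewrite indicE xi.
  have mu_omega : (@lebesgue_measure R) [set` omega L r M i.+1] = (2 * h)%:E.
    rewrite lebesgue_measure_itv /= -/h lte_fin.
    have -> : Defs.center L M i.+1 - h < Defs.center L M i.+1 + h.
      by have := h0; lra.
    by rewrite -EFinB; congr EFin; ring.
  rewrite Rintegral_cst// mul1r; apply: (etrans (congr1 fine mu_omega)).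
  by rewrite /= mulr1n /h; field; rewrite gt_eqF.
rewrite (@eq_Rintegral _ _ _ _ _ (cst 0)).
  by rewrite Rintegral_cst// mul0r.
move=> x xi; rewrite indicE; case: (boolP (x \in _)) => // xj.
move: ij; rewrite neq_ltn => /orP[] lt_ij.
  by case: (omega_disjoint _ _ _ lt_ij xi xj).
by case: (omega_disjoint _ _ _ lt_ij xj xi).
Qed.

Lemma inner_indicator_mode j k : (j < M)%N -> (0 < k)%N ->
  L2_inner (indicator L (omega L r M j.+1)) (mode k) =
  2 / freq k * sin (freq k * h) * sin (k%:R * pi * (j.+1%:R / M.+1%:R)).
Proof.
move=> jM k0; have fk0 := freq_gt0 k k0.
rewrite L2_inner_Lspace_of Rintegral_indicM; last exact: omega_sub.
rewrite dirichlet_modeE Rintegral_sinM ?gt_eqF//; last by have := h0; rewrite -/h; lra.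
(* The difference of cosines at the two ends is [2 sin (freq k * h)] times the sine at the center:
   the first factor depends on [k] only, the second is the entry of the sine transform. *)
rewrite -/h mulrBr mulrDr cosB cosD.
have -> : k%:R * pi * (j.+1%:R / M.+1%:R) = freq k * Defs.center L M j.+1.
  have : (0 : R) < M.+1%:R by rewrite ltr0n.
  rewrite /freq /Defs.center; move: M.+1%:R j.+1%:R => N J N0.
  by field; rewrite !gt_eqF.
by field; rewrite gt_eqF.
Qed.

Lemma oblique_projection_norm :
  let U := actuator_span L r M in
  let Eperp := orthogonal_compl (eigenspan L M) in
  direct_sum U Eperp /\
  opnorm (oblique_proj U Eperp) =
    (Num.sqrt (r * pi ^+ 2 / (4 * sin (r * pi / 2) ^+ 2) * (M%:R / (M%:R + 1))))%:E.
Proof.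
move=> U Eperp.
have mM : (M.-1 < M)%N by rewrite prednK.
(* Indices start at [0], so this is the mode of number [M], the highest one. *)
pose m : 'I_M := Ordinal mM.
pose D (i : 'I_M) := 2 / freq i.+1 * sin (freq i.+1 * h).
have ee (i k : 'I_M) : L2_inner (mode i.+1) (mode k.+1) = (L / 2) *+ (i == k).
  by rewrite inner_mode.
have ue (j i : 'I_M) : L2_inner (indicator L (omega L r M j.+1)) (mode i.+1) =
    D i * sin (i.+1%:R * pi * (j.+1%:R / M.+1%:R)).
  exact: inner_indicator_mode.
have SC (i j : 'I_M) : sin (i.+1%:R * pi * (j.+1%:R / M.+1%:R)) =
    sin (j.+1%:R * pi * (i.+1%:R / M.+1%:R)) :> R.
  by congr sin; ring.
have SS (i k : 'I_M) : \sum_(j < M) sin (i.+1%:R * pi * (j.+1%:R / M.+1%:R)) *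
    sin (k.+1%:R * pi * (j.+1%:R / M.+1%:R)) = (M.+1%:R / 2) *+ (i == k) :> R.
  have := @sine_orthogonality R M.+1 i.+1 k.+1.
  rewrite !ltnS !ltn_ord => /(_ isT isT).
  (* Orthogonality holds on the grid of [M + 1] points starting at [0]; the term at [0] vanishes and
     the [M] centers remain. *)
  rewrite big_ord_recl mul0r mulr0 sin0 mul0r add0r => <-.
  by apply: eq_bigr => j _.
have s0 : 0 < sin (r * pi / 2).
  have pi0 := @pi_gt0 R.
  have rpi : 0 < r * pi by rewrite mulr_gt0.
  have rpi' : r * pi < pi by rewrite gtr_pMl.
  by apply: sin_gt0_pi; apply/andP; split; lra.
have DE (i : 'I_M) : D i = 2 * L / pi * (sin (i.+1%:R * (r * pi / (2 * M%:R))) / i.+1%:R).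
  rewrite /D /freq /h.
  have -> : i.+1%:R * pi / L * (r * L / (2 * M%:R)) = i.+1%:R * (r * pi / (2 * M%:R)).
    by field; rewrite !gt_eqF.
  have : (0 : R) < i.+1%:R by rewrite ltr0n.
  have := @pi_gt0 R; move: (sin _) => s; move: pi i.+1%:R => p I p0 I0.
  by field; rewrite !gt_eqF.
have Ma : M%:R * (r * pi / (2 * M%:R)) = r * pi / 2 by field; rewrite gt_eqF.
have Dm_eq : D m = 2 * L / pi * (sin (r * pi / 2) / M%:R).
  by rewrite DE [nat_of_ord m]/= prednK// Ma.
have pi0 := @pi_gt0 R.
have Dm0 : 0 < D m by rewrite Dm_eq mulr_gt0// divr_gt0// mulr_gt0.
(* Up to a common factor [D i] is [sin ((i + 1) a) / (i + 1)] with [a = r pi / (2 M)]. Since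
   [r < 1], the largest angle [M a = r pi / 2] stays below [pi / 2]. *)
have Dm i : D m <= D i.
  rewrite Dm_eq DE ler_pM2l ?divr_gt0 ?mulr_gt0//.
  rewrite ler_pdivlMr ?ltr0n// mulrAC ler_pdivrMr//.
  rewrite [leLHS]mulrC [leRHS]mulrC -Ma; apply: natmul_sin_le => //.
  - by rewrite divr_ge0 ?mulr_ge0// ltW.
  - by rewrite Ma ler_pM2r// ler_piMl ?ltW.
have c0 : 0 < L / 2 by rewrite divr_gt0.
have d0 : 0 < r * L / M%:R by rewrite divr_gt0 ?mulr_gt0.
have sigma0 : 0 < M.+1%:R / 2 :> R by rewrite divr_gt0.
pose S (i j : 'I_M) : R := sin (i.+1%:R * pi * (j.+1%:R / M.+1%:R)).
have L2C := @L2_innerC R L; have L2l := @L2_inner_linear R L.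
have L2xx := @L2_innerxx R L.
split.
  exact: (@direct_sum_ip_compl R (L2 L) (@L2_inner R L) L2C L2l L2xx M _ _ _ _ _ D S
    c0 d0 sigma0 ee inner_indicator ue SC SS m Dm0 Dm).
rewrite (@opnorm_oblique_proj R (L2 L) (@L2_inner R L) L2C L2l L2xx M _ _ _ _ _ D S
  c0 d0 sigma0 ee inner_indicator ue SC SS m Dm0 Dm).
(* Writing [D m] as the root of its square puts everything under one root, where [L] cancels. *)
congr EFin; rewrite -[D m](@ger0_norm _ (D m)) ?ltW// -sqrtr_sqr -sqrtrV ?sqr_ge0//.
rewrite -sqrtrM; last by rewrite ltW// divr_gt0// mulr_gt0.
congr Num.sqrt; rewrite Dm_eq -[M.+1%:R]natr1.
move: s0 pi0; move: (sin _) => s; move: pi => p s0 p0.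
by field; rewrite !gt_eqF// addr_gt0.
Qed.

End actuators.

(** * Closed formula, monotonicity and limit of the norms *)

Lemma cvg_natr_ratio (R : realType) : M%:R / (M%:R + 1) @[M --> \oo] --> (1 : R).
Proof.
have -> : (fun M : nat => M%:R / (M%:R + 1)) = (fun M => 1 - harmonic M) :> (nat -> R).
  apply/funext => M; rewrite /harmonic /= -natr1.
  by field; rewrite natr1 pnatr_eq0.
by rewrite -[X in _ --> X]subr0; apply: cvgB; [exact: cvg_cst|exact: cvg_harmonic].
Qed.

Theorem theorem2p2 (R : realType) (L r : R) (hL : 0 < L) (hr : 0 < r < 1) :
  let U M := actuator_span L r M in
  let Eperp M := orthogonal_compl (eigenspan L M) in
  let normP M := opnorm (oblique_proj (U M) (Eperp M)) in
  [/\ forall M : nat, r / (1 - r) <= M%:R ->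
        direct_sum (U M) (Eperp M) /\
        normP M = ((4 * (M%:R + 1) / (r * pi ^+ 2 * M%:R)
                      * sin (r * pi / 2) ^+ 2) `^ (- (1 / 2)))%:E,
      forall M N : nat, r / (1 - r) <= M%:R -> (M < N)%N ->
        (normP M < normP N)%E &
      normP M @[M --> \oo] -->
        (Num.sqrt r * pi / (2 * sin (r * pi / 2)))%:E].
Proof.
move=> U Eperp normP.
have [r0 r1] := andP hr.
have pi0 := @pi_gt0 R.
have s0 : 0 < sin (r * pi / 2).
  apply: sin_gt0_pi; rewrite divr_gt0 ?mulr_gt0//= ltr_pdivrMr//.
  by rewrite mulrC ltr_pM2l//; lra.
(* The square of the limit. Once the norm is [sqrt (C * M / (M + 1))], growth and convergence both
   come from [M / (M + 1)]. *)
pose C := r * pi ^+ 2 / (4 * sin (r * pi / 2) ^+ 2).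
have C0 : 0 < C by rewrite divr_gt0// !mulr_gt0// exprn_gt0.
have Mpos M : r / (1 - r) <= M%:R -> (0 < M)%N.
  by move=> rM; rewrite -(ltr0n R); apply: lt_le_trans rM; rewrite divr_gt0// subr_gt0.
have normPE M : r / (1 - r) <= M%:R ->
    normP M = (Num.sqrt (C * (M%:R / (M%:R + 1))))%:E.
  by move=> rM; have [] := oblique_projection_norm R L r M hL hr (Mpos M rM) rM.
split.
- move=> M rM; split.
    by have [] := oblique_projection_norm R L r M hL hr (Mpos M rM) rM.
  have M0 : (0 : R) < M%:R by rewrite ltr0n Mpos.
  have M1 : 0 < M%:R + 1 :> R by rewrite addr_gt0.
  have A0 : 0 < 4 * (M%:R + 1) / (r * pi ^+ 2 * M%:R) * sin (r * pi / 2) ^+ 2.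
    by rewrite mulr_gt0 ?exprn_gt0// divr_gt0 ?mulr_gt0 ?exprn_gt0.
  rewrite normPE// powRN mul1r powR12_sqrt ?(ltW A0)// -sqrtrV ?(ltW A0)//.
  congr (_%:E); congr Num.sqrt; rewrite /C.
  move: s0 pi0; move: (sin _) => s; move: pi => p s0' p0.
  by field; rewrite !gt_eqF.
- move=> M N rM MN.
  have M0 : (0 : R) < M%:R by rewrite ltr0n Mpos.
  have MN' : M%:R < N%:R :> R by rewrite ltr_nat.
  rewrite !normPE//; last by rewrite (le_trans rM)// ltW.
  have N0 := lt_trans M0 MN'.
  have ratio_gt0 : 0 < C * (N%:R / (N%:R + 1)).
    by rewrite mulr_gt0// divr_gt0// addr_gt0.
  rewrite lte_fin (ltr_sqrt _ ratio_gt0) ltr_pM2l//.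
  by rewrite ltr_pdivlMr ?addr_gt0// mulrAC ltr_pdivrMr ?addr_gt0//; lra.
- have -> : Num.sqrt r * pi / (2 * sin (r * pi / 2)) = Num.sqrt (C * 1).
    rewrite mulr1; apply/esym/eqP; rewrite -(@eqrXn2 _ 2)//; last first.
      by rewrite divr_ge0// mulr_ge0// ltW.
    rewrite sqr_sqrtr ?(ltW C0)// !exprMn exprVn sqr_sqrtr ?(ltW r0)// /C.
    by apply/eqP; rewrite exprMn; field; rewrite gt_eqF.
  have : (Num.sqrt (C * (M%:R / (M%:R + 1))))%:E @[M --> \oo] --> (Num.sqrt (C * 1))%:E.
    apply: cvg_EFin; first by near=> M.
    apply: (@cvg_comp _ _ _ _ Num.sqrt _ (nbhs (C * 1))); last exact: sqrt_continuous.
    by apply: cvgM; [exact: cvg_cst|exact: cvg_natr_ratio].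
  (* The formula for the norm is available only for [M >= r / (1 - r)], hence eventually, which
     suffices for the limit. *)
  apply: cvg_trans; apply: near_eq_cvg; near=> M.
  by rewrite normPE//; near: M; exact: nbhs_infty_ger.
Unshelve. all: by end_near. Qed.
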